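(* Consider the generalized coupled nonlinear Schrödinger system $$i\psi_t=-a(t)\psi_{xx}+(b(t)x^2-id(t)-xf(t))\psi+i(g(t)-c(t)x)\psi_x+h(t)(|\varphi|^{2s}+|\psi|^{2s})\psi,$$ $$i\varphi_t=-a(t)\varphi_{xx}+(b(t)x^2-id(t)-xf(t))\varphi+i(g(t)-c(t)x)\varphi_x+h(t)(|\varphi|^{2s}+|\psi|^{2s})\varphi,$$ where $a(t),b(t),c(t),d(t),f(t),g(t),h(t)$ are time-dependent functions and $s>0$. Then the system admits the $L^\infty$ singular solutions (solutions with a singularity in finite time in the $L^\infty$ norm) $$\psi(x,t)=\frac{1}{\sqrt{\mu(t)}}\exp\left[i\left(\alpha(t)x^2+\beta(t)xy+\gamma(t)y^2+\delta(t)x+\varepsilon(t)y+\kappa(t)\right)\right],$$ $$\varphi(x,t)=\frac{1}{\sqrt{\mu(t)}}\exp\left[i\left(\alpha(t)x^2+\beta(t)xz+\gamma(t)z^2+\delta(t)x+\varepsilon(t)z+\kappa(t)\right)\right],$$ where $y,z$ are real parameters and $\alpha(t),\beta(t),\gamma(t),\delta(t),\varepsilon(t),\kappa(t),\mu(t)$ satisfy the modified Riccati system $$\alpha'+b+2c\alpha+4a\alpha^2=0,\quad \beta'+(c+4a\alpha)\beta=0,\quad \gamma'+a\beta^2=0,$$ $$\delta'+(c+4a\alpha)\delta=f+2\alpha g,\quad \varepsilon'=(g-2a\delta)\beta,\quad \kappa'=g\delta-a\delta^2-\frac{2h}{\mu^{s}}.$$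
   Context: Primes denote $d/dt$. The function $\mu$ is linked to $\alpha$ by the substitution $\alpha=\dfrac{\mu'}{4a\mu}-\dfrac{d}{2a}$. ''$L^\infty$ singular'' means finite-time blow-up in the $L^\infty$ norm: $|\psi(x,t)|,|\varphi(x,t)|\to\infty$ as $t\to T_b$ for some finite time $T_b$.
   Formalization: Not every solution of the Riccati system blows up: singularity is asserted when μ→0 at a finite time, and existence of singular solutions is asserted for continuous coefficients; a(t)≠0 and μ>0 are assumed on the time interval, as the formulas require. *)

(* Defs.v *)
From Stdlib Require Export Reals.
From Coquelicot Require Export Coquelicot.
Open Scope R_scope.

Definition time_itv (T0 T1 : Rbar) (t : R) : Prop :=
  Rbar_lt T0 t /\ Rbar_lt t T1.

(** Stdlib's [Rpower] is [1] at base [0]; here [0] to a positive power is [0]. *)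
Definition rpow (x p : R) : R :=
  if Req_EM_T x 0 then 0 else Rpower x p.

Definition Cexp (w : C) : C :=
  (exp (Re w) * cos (Im w), exp (Re w) * sin (Im w)).

(** Derivative of a complex-valued function of one real variable. *)
Definition is_derive_RC (u : R -> C) (x : R) (l : C) : Prop :=
  @is_derive R_AbsRing C_R_NormedModule u x l.

(** The right-hand side of the equation for [u] at [(x, t)]; the arguments [ux],
    [uxx] are the values of its space derivatives and [p] is the value of
    |phi|^{2s} + |psi|^{2s}. *)
Definition nls_rhs (a b c d f g h : R -> R) (p x t : R) (u ux uxx : C) : C :=
  (- RtoC (a t) * uxx
   + (RtoC (b t * x ^ 2) - Ci * RtoC (d t) - RtoC (x * f t)) * u
   + Ci * RtoC (g t - c t * x) * ux
   + RtoC (h t * p) * u)%C.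

(** Classical solutions on the whole line, for times in [J].  Functions of space
    and time take their arguments in the order [x], [t]. *)
Definition solves_coupled_nls (a b c d f g h : R -> R) (s : R)
    (J : R -> Prop) (psi phi : R -> R -> C) : Prop :=
  exists psi_t psi_x psi_xx phi_t phi_x phi_xx : R -> R -> C,
  forall x t : R, J t ->
    let p := rpow (Cmod (phi x t)) (2 * s) + rpow (Cmod (psi x t)) (2 * s) in
    is_derive_RC (fun t' => psi x t') t (psi_t x t) /\
    is_derive_RC (fun x' => psi x' t) x (psi_x x t) /\
    is_derive_RC (fun x' => psi_x x' t) x (psi_xx x t) /\
    is_derive_RC (fun t' => phi x t') t (phi_t x t) /\
    is_derive_RC (fun x' => phi x' t) x (phi_x x t) /\
    is_derive_RC (fun x' => phi_x x' t) x (phi_xx x t) /\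
    (Ci * psi_t x t)%C =
      nls_rhs a b c d f g h p x t (psi x t) (psi_x x t) (psi_xx x t) /\
    (Ci * phi_t x t)%C =
      nls_rhs a b c d f g h p x t (phi x t) (phi_x x t) (phi_xx x t).

(** Besides the six equations, [mu] is positive (so that [1 / sqrt mu] makes
    sense) and is tied to [alpha] by alpha = mu' / (4 a mu) - d / (2 a). *)
Definition modified_riccati (a b c d f g h : R -> R) (s : R) (J : R -> Prop)
    (alpha beta gamma delta eps kappa mu : R -> R) : Prop :=
  forall t : R, J t ->
    0 < mu t /\
    ex_derive mu t /\
    alpha t = Derive mu t / (4 * a t * mu t) - d t / (2 * a t) /\
    ex_derive alpha t /\ ex_derive beta t /\ ex_derive gamma t /\
    ex_derive delta t /\ ex_derive eps t /\ ex_derive kappa t /\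
    Derive alpha t + b t + 2 * c t * alpha t + 4 * a t * alpha t ^ 2 = 0 /\
    Derive beta t + (c t + 4 * a t * alpha t) * beta t = 0 /\
    Derive gamma t + a t * beta t ^ 2 = 0 /\
    Derive delta t + (c t + 4 * a t * alpha t) * delta t
      = f t + 2 * alpha t * g t /\
    Derive eps t = (g t - 2 * a t * delta t) * beta t /\
    Derive kappa t
      = g t * delta t - a t * delta t ^ 2 - 2 * h t / Rpower (mu t) s.

(** Used with parameter [y] for psi and [z] for phi. *)
Definition ansatz (alpha beta gamma delta eps kappa mu : R -> R)
    (y x t : R) : C :=
  (RtoC (1 / sqrt (mu t)) *
   Cexp (Ci * RtoC (alpha t * x ^ 2 + beta t * x * y + gamma t * y ^ 2
                    + delta t * x + eps t * y + kappa t)))%C.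

(** Supremum of the modulus: the L^oo norm of a continuous function. *)
Definition Linf_norm (v : R -> C) : Rbar :=
  Lub_Rbar (fun r => exists x : R, r = Cmod (v x)).

(** [u] is bounded in space at each time in [(T0, Tb)], and as t increases to
    [Tb] both its L^oo norm and |u(x,t)|, for each fixed x, tend to infinity. *)
Definition Linf_singular (T0 : Rbar) (Tb : R) (u : R -> R -> C) : Prop :=
  (forall t : R, time_itv T0 Tb t -> is_finite (Linf_norm (fun x => u x t))) /\
  (forall M : R, at_left Tb (fun t => Rbar_lt M (Linf_norm (fun x => u x t)))) /\
  (forall x : R,
     filterlim (fun t => Cmod (u x t)) (at_left Tb) (Rbar_locally p_infty)).

(* Main.v *)
(** Writing u = exp(i S) / sqrt mu with S quadratic in x, the imaginary part of the
    equation divided by u is the relation between alpha and mu, and the real part is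
    a quadratic polynomial in (x, y) whose six coefficients are the Riccati equations.
    Since |u| = 1 / sqrt mu does not depend on x, u blows up where mu vanishes.

    For existence, y = 1 / alpha solves y' = b y^2 + 2 c y + 4 a, which can be solved
    backwards from y(Tb) = 0; since a <> 0, y has no other zero close to Tb, at a
    distance uniform in Tb, so Tb may be chosen just after t0.  Then
    mu = mu0 y / y(t0) exp(int (2 d - b y - 2 c)) vanishes at Tb, and the other
    functions are obtained by quadratures. *)
Require Import Defs.
From Stdlib Require Import Reals Lra Lia.
From Coquelicot Require Import Coquelicot.
Open Scope R_scope.

(** * Differentiation of complex-valued functions in Cartesian and polar form *)

Lemma is_derive_RC_pair (u v : R -> R) (x du dv : R) :
  is_derive u x du -> is_derive v x dv ->
  is_derive_RC (fun t => (u t, v t)) x (du, dv).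
Proof.
  intros Hu Hv. unfold is_derive_RC.
  (* The pair is a real combination of the fixed vectors [(1, 0)] and [(0, 1)], to which the rules
     for sums and scalar multiples apply. *)
  apply (@is_derive_ext R_AbsRing C_R_NormedModule
    (fun t => plus (scal (u t) ((1, 0) : C_R_NormedModule))
                   (scal (v t) ((0, 1) : C_R_NormedModule)))).
  - intros t. unfold plus, scal; simpl. unfold prod_plus, prod_scal; simpl.
    unfold plus, scal, mult; simpl; unfold mult; simpl. f_equal; ring.
  - replace ((du, dv) : C_R_NormedModule)
      with (plus (scal du ((1, 0) : C_R_NormedModule))
                 (scal dv ((0, 1) : C_R_NormedModule))).
    + apply (@is_derive_plus R_AbsRing C_R_NormedModule);
        apply (@is_derive_scal_l R_AbsRing C_R_NormedModule); assumption.
    + unfold plus, scal; simpl. unfold prod_plus, prod_scal; simpl.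
      unfold plus, scal, mult; simpl; unfold mult; simpl. f_equal; ring.
Qed.

(** Keeping amplitude and phase real reduces every derivative of the ansatz to derivatives of two
    real functions. *)
Definition polar (r th : R) : C := (r * cos th, r * sin th).

Lemma Cmod_polar (r th : R) : 0 <= r -> Cmod (polar r th) = r.
Proof.
  intros Hr. unfold polar, Cmod; simpl.
  replace (_ + _) with (r * r * (Rsqr (sin th) + Rsqr (cos th)))
    by (unfold Rsqr; ring).
  rewrite sin2_cos2, Rmult_1_r. now apply sqrt_square.
Qed.

Lemma is_derive_RC_polar (r th : R -> R) (x dr dth : R) :
  is_derive r x dr -> is_derive th x dth ->
  is_derive_RC (fun t => polar (r t) (th t)) x
    (dr * cos (th x) - r x * sin (th x) * dth,
     dr * sin (th x) + r x * cos (th x) * dth).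
Proof.
  intros Hr Hth. apply is_derive_RC_pair.
  - evar_last.
    + apply (is_derive_mult r (fun t => cos (th t)) x); [exact Hr| |exact Rmult_comm].
      apply (is_derive_comp cos th); [apply is_derive_cos|exact Hth].
    + unfold plus, mult, scal; simpl; unfold mult; simpl. ring.
  - evar_last.
    + apply (is_derive_mult r (fun t => sin (th t)) x); [exact Hr| |exact Rmult_comm].
      apply (is_derive_comp sin th); [apply is_derive_sin|exact Hth].
    + unfold plus, mult, scal; simpl; unfold mult; simpl. ring.
Qed.

Definition phase (alpha beta gamma delta eps kappa : R -> R) (y x t : R) : R :=
  alpha t * x ^ 2 + beta t * x * y + gamma t * y ^ 2
  + delta t * x + eps t * y + kappa t.

Lemma ansatz_polar (alpha beta gamma delta eps kappa mu : R -> R) (y x t : R) :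
  ansatz alpha beta gamma delta eps kappa mu y x t =
  polar (1 / sqrt (mu t)) (phase alpha beta gamma delta eps kappa y x t).
Proof.
  unfold ansatz, polar, Cexp, phase.
  set (w := _ + kappa t).
  assert (Hre : Re (Ci * RtoC w) = 0) by (simpl; ring).
  assert (Him : Im (Ci * RtoC w) = w) by (simpl; ring).
  rewrite Hre, Him, exp_0.
  unfold RtoC, Cmult; simpl. f_equal; ring.
Qed.

Lemma rpow_inv_sqrt (m s : R) :
  0 < m -> rpow (1 / sqrt m) (2 * s) = / Rpower m s.
Proof.
  intros Hm. unfold rpow.
  assert (Hs : 0 < sqrt m) by now apply sqrt_lt_R0.
  assert (Hi : 0 < 1 / sqrt m) by (apply Rdiv_lt_0_compat; lra).
  destruct (Req_EM_T (1 / sqrt m) 0) as [E|_]; [lra|].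
  rewrite <- Rpower_sqrt by exact Hm.
  unfold Rdiv. rewrite Rmult_1_l, <- Rpower_Ropp, Rpower_mult, <- Rpower_Ropp.
  f_equal. field.
Qed.

(** * The ansatz as a solution of the coupled system *)

Section Ansatz.

Variables (a b c d f g h : R -> R) (s : R) (J : R -> Prop)
  (alpha beta gamma delta eps kappa mu : R -> R).
Hypothesis ha : forall t : R, J t -> a t <> 0.
Hypothesis ric : modified_riccati a b c d f g h s J
  alpha beta gamma delta eps kappa mu.

Let amp (t : R) : R := 1 / sqrt (mu t).
Let theta := phase alpha beta gamma delta eps kappa.
Let theta_x (y x t : R) : R := 2 * alpha t * x + beta t * y + delta t.
(** From (mu^(-1/2))' = -(mu' / (2 mu)) mu^(-1/2). *)
Let amp' (t : R) : R := - (Derive mu t / (2 * mu t)) * amp t.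
(** The phase is linear in its six coefficient functions, so a time derivative replaces each of them
    by its derivative. *)
Let theta_t := phase (Derive alpha) (Derive beta) (Derive gamma)
  (Derive delta) (Derive eps) (Derive kappa).
Let psi := ansatz alpha beta gamma delta eps kappa mu.
Let psi_t (y x t : R) : C :=
  (amp' t * cos (theta y x t) - amp t * sin (theta y x t) * theta_t y x t,
   amp' t * sin (theta y x t) + amp t * cos (theta y x t) * theta_t y x t).
Let psi_x (y x t : R) : C :=
  (- (amp t * sin (theta y x t) * theta_x y x t),
   amp t * cos (theta y x t) * theta_x y x t).
(** The amplitude is constant in [x], and the second space derivative of the phase is
    [2 * alpha t]. *)
Let psi_xx (y x t : R) : C :=
  (- (amp t * (cos (theta y x t) * theta_x y x t ^ 2
               + sin (theta y x t) * (2 * alpha t))),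
   amp t * (- sin (theta y x t) * theta_x y x t ^ 2
            + cos (theta y x t) * (2 * alpha t))).

Lemma is_derive_ansatz_t (y x t : R) :
  J t -> is_derive_RC (fun t' => psi y x t') t (psi_t y x t).
Proof.
  intros Jt.
  destruct (ric t Jt) as (Hm & Dm & _ & Da & Db & Dg & Dd & De & Dk & _).
  unfold is_derive_RC.
  apply (@is_derive_ext R_AbsRing C_R_NormedModule
    (fun t' => polar (amp t') (theta y x t'))).
  { intros t'. symmetry. apply ansatz_polar. }
  apply is_derive_RC_polar.
  - unfold amp', amp. assert (Hs : 0 < sqrt (mu t)) by now apply sqrt_lt_R0.
    auto_derive; [repeat split; auto; lra|].
    change (Derive (fun x0 => mu x0) t) with (Derive mu t).
    rewrite sqrt_sqrt by lra.
    field. lra.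
  - unfold theta, theta_t, phase. auto_derive; [tauto|].
    change (Derive (fun x0 => alpha x0) t) with (Derive alpha t).
    change (Derive (fun x0 => beta x0) t) with (Derive beta t).
    change (Derive (fun x0 => gamma x0) t) with (Derive gamma t).
    change (Derive (fun x0 => delta x0) t) with (Derive delta t).
    change (Derive (fun x0 => eps x0) t) with (Derive eps t).
    change (Derive (fun x0 => kappa x0) t) with (Derive kappa t).
    ring.
Qed.

Lemma is_derive_ansatz_x (y x t : R) :
  is_derive_RC (fun x' => psi y x' t) x (psi_x y x t).
Proof.
  unfold is_derive_RC.
  apply (@is_derive_ext R_AbsRing C_R_NormedModule
    (fun x' => polar (amp t) (theta y x' t))).
  { intros x'. symmetry. apply ansatz_polar. }
  replace (psi_x y x t) with
    ((0 * cos (theta y x t) - amp t * sin (theta y x t) * theta_x y x t,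
      0 * sin (theta y x t) + amp t * cos (theta y x t) * theta_x y x t) : C)
    by (unfold psi_x; f_equal; ring).
  apply (is_derive_RC_polar (fun _ => amp t) (fun x' => theta y x' t)).
  - auto_derive; auto.
  - unfold theta, theta_x, phase. auto_derive; [auto|ring].
Qed.

Lemma is_derive_ansatz_xx (y x t : R) :
  is_derive_RC (fun x' => psi_x y x' t) x (psi_xx y x t).
Proof.
  unfold psi_x, psi_xx, theta, theta_x, phase.
  apply is_derive_RC_pair; (auto_derive; [auto|simpl pow; ring]).
Qed.

(** Both moduli equal 1 / sqrt mu whatever the parameter, so [p] is 2 / mu^s; the parameter [w] then
    serves for either equation. *)
Lemma ansatz_nls (y z x t : R) :
  J t ->
  let p := rpow (Cmod (psi z x t)) (2 * s) + rpow (Cmod (psi y x t)) (2 * s) in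
  forall w : R,
  (Ci * psi_t w x t)%C =
    nls_rhs a b c d f g h p x t (psi w x t) (psi_x w x t) (psi_xx w x t).
Proof.
  intros Jt p w.
  destruct (ric t Jt)
    as (Hm & _ & Ea & _ & _ & _ & _ & _ & _ & E1 & E2 & E3 & E4 & E5 & E6).
  assert (Ha := ha t Jt).
  assert (Hamp : 0 < 1 / sqrt (mu t))
    by (apply Rdiv_lt_0_compat; [lra|now apply sqrt_lt_R0]).
  assert (Hp : p = 2 / Rpower (mu t) s).
  { unfold p, psi. rewrite !ansatz_polar, !Cmod_polar by lra.
    rewrite !rpow_inv_sqrt by exact Hm. unfold Rdiv. ring. }
  rewrite Hp. clear p Hp.
  (* The imaginary part of the equation: the relation between alpha and mu says mu' / (2 mu) = 2 a
     alpha + d. *)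
  assert (Hmu : amp' t = - (2 * a t * alpha t + d t) * amp t).
  { unfold amp'. rewrite Ea. field. lra. }
  set (P := 2 / Rpower (mu t) s).
  assert (HP : Derive kappa t = g t * delta t - a t * delta t ^ 2 - h t * P).
  { rewrite E6. unfold P, Rdiv. ring. }
  (* The real part, a Hamilton-Jacobi equation for the phase: each Riccati equation gives one
     coefficient of a polynomial in [x] and [w]. *)
  assert (Hth : theta_t w x t =
    - (a t * theta_x w x t ^ 2 + b t * x ^ 2 - x * f t
       - (g t - c t * x) * theta_x w x t + h t * P)).
  { unfold theta_t, theta_x, phase. rewrite HP, E5.
    replace (Derive alpha t)
      with (- (b t + 2 * c t * alpha t + 4 * a t * alpha t ^ 2)) by lra.
    replace (Derive beta t) with (- ((c t + 4 * a t * alpha t) * beta t)) by lra.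
    replace (Derive gamma t) with (- (a t * beta t ^ 2)) by lra.
    replace (Derive delta t)
      with (f t + 2 * alpha t * g t - (c t + 4 * a t * alpha t) * delta t) by lra.
    ring. }
  unfold psi. rewrite ansatz_polar. fold (amp t) (theta w x t).
  unfold nls_rhs, psi_t, psi_x, psi_xx, polar. rewrite Hmu, Hth.
  (* Both sides are linear in [cos] and [sin] of the phase, so [ring] closes the goal without any
     trigonometric identity. *)
  unfold Cmult, Cplus, Cminus, Copp, RtoC, Ci; simpl. f_equal; ring.
Qed.

Lemma ansatz_solves (y z : R) : solves_coupled_nls a b c d f g h s J (psi y) (psi z).
Proof.
  exists (psi_t y), (psi_x y), (psi_xx y), (psi_t z), (psi_x z), (psi_xx z).
  intros x t Jt p.
  repeat match goal with |- _ /\ _ => split end.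
  all: first [ now apply is_derive_ansatz_t | apply is_derive_ansatz_x
             | apply is_derive_ansatz_xx | now apply ansatz_nls ].
Qed.

End Ansatz.

(** * Blow-up where mu tends to zero *)

Lemma Linf_norm_const (v : R -> C) (k : R) :
  (forall x : R, Cmod (v x) = k) -> Linf_norm v = k.
Proof.
  intros Hv. apply is_lub_Rbar_unique. split.
  - intros r [x ->]. rewrite Hv. apply Rle_refl.
  - intros l Hl. apply Hl. exists 0. now rewrite Hv.
Qed.

Lemma ansatz_singular (T0 : Rbar) (Tb : R)
    (alpha beta gamma delta eps kappa mu : R -> R) (y : R) :
  Rbar_lt T0 Tb ->
  (forall t : R, time_itv T0 Tb t -> 0 < mu t) ->
  filterlim mu (at_left Tb) (locally 0) ->
  Linf_singular T0 Tb (ansatz alpha beta gamma delta eps kappa mu y).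
Proof.
  intros HT Hmu Hlim.
  assert (Hmod : forall t, time_itv T0 Tb t -> forall x,
    Cmod (ansatz alpha beta gamma delta eps kappa mu y x t) = 1 / sqrt (mu t)).
  { intros t Ht x. rewrite ansatz_polar. apply Cmod_polar.
    apply Rlt_le, Rdiv_lt_0_compat; [lra|]. now apply sqrt_lt_R0, Hmu. }
  assert (Hnear : at_left Tb (time_itv T0 Tb)).
  { apply (locally_interval _ Tb T0 p_infty HT I).
    intros t H0 _ Ht. now split. }
  assert (Hbig : forall M : R, at_left Tb (fun t => M < 1 / sqrt (mu t))).
  { intros M. set (K := Rabs M + 1).
    assert (HK : 0 < K) by (unfold K; pose proof (Rabs_pos M); lra).
    assert (HKi : 0 < / K) by now apply Rinv_0_lt_compat.
    assert (He : 0 < / K * / K) by now apply Rmult_lt_0_compat.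
    generalize (filter_and _ _ Hnear (Hlim _ (locally_ball 0 (mkposreal _ He)))).
    apply filter_imp. intros t [Ht Hb].
    assert (H0 := Hmu t Ht).
    assert (Hb' : Rabs (mu t - 0) < / K * / K) by exact Hb.
    rewrite Rminus_0_r, Rabs_pos_eq in Hb' by lra.
    assert (Hs : sqrt (mu t) < / K).
    { rewrite <- (sqrt_square (/ K)) by lra. apply sqrt_lt_1; lra. }
    assert (Hsp : 0 < sqrt (mu t)) by now apply sqrt_lt_R0.
    apply Rlt_trans with K; [unfold K; pose proof (Rle_abs M); lra|].
    unfold Rdiv. rewrite Rmult_1_l, <- (Rinv_inv K).
    apply Rinv_lt_contravar; [now apply Rmult_lt_0_compat|exact Hs]. }
  split; [|split].
  - intros t Ht. now rewrite (Linf_norm_const _ _ (Hmod t Ht)).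
  - intros M. generalize (filter_and _ _ Hnear (Hbig M)). apply filter_imp.
    intros t [Ht HM]. now rewrite (Linf_norm_const _ _ (Hmod t Ht)).
  - intros x P [M HM]. unfold filtermap.
    generalize (filter_and _ _ Hnear (Hbig M)). apply filter_imp.
    intros t [Ht Hl]. apply HM. now rewrite Hmod.
Qed.

(** * Truncation to an interval and a contraction principle *)

(** For l <= u this is the nearest-point projection onto [l, u]; composing with it extends data from
    an interval continuously to the whole line. *)
Definition clamp (l u x : R) : R := Rmax l (Rmin u x).

Lemma clamp_bounds (l u x : R) : l <= u -> l <= clamp l u x <= u.
Proof.
  intros H. unfold clamp, Rmax, Rmin.
  destruct (Rle_dec u x), (Rle_dec l _); lra.
Qed.

Lemma clamp_id (l u x : R) : l <= x <= u -> clamp l u x = x.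
Proof. intros H. unfold clamp. rewrite Rmin_right, Rmax_right; lra. Qed.

Lemma clamp_lipschitz (l u x y : R) : Rabs (clamp l u x - clamp l u y) <= Rabs (x - y).
Proof.
  unfold clamp, Rmax, Rmin, Rabs.
  destruct (Rle_dec u x), (Rle_dec u y); repeat destruct (Rle_dec l _);
    repeat destruct (Rcase_abs _); lra.
Qed.

Lemma lipschitz_continuous (u : R -> R) (L : R) :
  (forall x y, Rabs (u x - u y) <= L * Rabs (x - y)) -> forall x, continuous u x.
Proof.
  intros H x. apply continuity_pt_filterlim. intros e He.
  (* [Rabs L + 1] is a positive substitute for [L], whose sign is unknown. *)
  exists (e / (Rabs L + 1)).
  assert (HL : 0 < Rabs L + 1) by (pose proof (Rabs_pos L); lra).
  split; [apply Rdiv_lt_0_compat; lra|].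
  intros y [_ Hy]. unfold dist, R_met, R_dist in *; simpl in *.
  unfold Rdist in *.
  apply Rle_lt_trans with (1 := H y x).
  apply Rle_lt_trans with ((Rabs L + 1) * Rabs (y - x)).
  { apply Rmult_le_compat_r; [apply Rabs_pos|]. pose proof (Rle_abs L); lra. }
  apply Rmult_lt_compat_l with (r := Rabs L + 1) in Hy; [|exact HL].
  replace ((Rabs L + 1) * (e / (Rabs L + 1))) with e in Hy by (field; lra).
  exact Hy.
Qed.

Lemma clamp_continuous (l u x : R) : continuous (clamp l u) x.
Proof.
  apply (lipschitz_continuous _ 1). intros y z. rewrite Rmult_1_l. apply clamp_lipschitz.
Qed.

Lemma continuous_comp_clamp (u : R -> R) (l r : R) :
  l <= r -> (forall t, l <= t <= r -> continuous u t) ->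
  forall t, continuous (fun t' => u (clamp l r t')) t.
Proof.
  intros Hlr Hu t. apply (continuous_comp (clamp l r) u).
  - apply clamp_continuous.
  - now apply Hu, clamp_bounds.
Qed.

(** An eps/3 argument: one index [n] with [e n] below eps / 3 serves all points at once. *)
Lemma uniform_limit_continuous (u : nat -> R -> R) (v : R -> R) (e : nat -> R) :
  (forall n t, Rabs (v t - u n t) <= e n) -> is_lim_seq e 0 ->
  (forall n t, continuous (u n) t) -> forall t, continuous v t.
Proof.
  intros Hv He Hu t.
  apply filterlim_locally. intros eps.
  assert (H3 : 0 < eps / 3) by (pose proof (cond_pos eps); lra).
  destruct (He _ (locally_ball 0 (mkposreal _ H3))) as [n Hn].
  assert (Hen : Rabs (e n - 0) < eps / 3) by exact (Hn n (le_n n)).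
  apply Rabs_def2 in Hen.
  generalize (proj1 (filterlim_locally _ _) (Hu n t) (mkposreal _ H3)).
  apply filter_imp. intros x Hx.
  assert (Hx' : Rabs (u n x - u n t) < eps / 3) by exact Hx.
  change (Rabs (v x - v t) < eps).
  pose proof (Hv n x) as H1. pose proof (Hv n t) as H2.
  apply Rabs_def2 in Hx'. apply Rabs_le_between in H1. apply Rabs_le_between in H2.
  apply Rabs_def1; lra.
Qed.

Lemma is_lim_seq_geom_half (K : R) : is_lim_seq (fun n => K * (1 / 2) ^ n) 0.
Proof.
  replace (Finite 0) with (Rbar_mult K 0) by (simpl; f_equal; ring).
  apply is_lim_seq_scal_l, is_lim_seq_geom. rewrite Rabs_pos_eq; lra.
Qed.

(** Banach's principle with factor 1/2 for the uniform distance, expressed through pointwise bounds.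
    [K] bounds the first step; the iterates of [u0] are uniformly Cauchy, so their limit is
    continuous. *)
Lemma contraction_fixed_point (F : (R -> R) -> R -> R) (u0 : R -> R) (K : R) :
  (forall t, continuous u0 t) ->
  (forall u, (forall t, continuous u t) -> forall t, continuous (F u) t) ->
  (forall t, Rabs (F u0 t - u0 t) <= K) ->
  (forall u v M, (forall t, continuous u t) -> (forall t, continuous v t) ->
     (forall t, Rabs (u t - v t) <= M) ->
     forall t, Rabs (F u t - F v t) <= M * (1 / 2)) ->
  exists w : R -> R, (forall t, continuous w t) /\ forall t, w t = F w t.
Proof.
  intros Hu0 HF HK Hc.
  set (u := fix u (n : nat) : R -> R :=
    match n with O => u0 | S n => F (u n) end).
  assert (Cu : forall n t, continuous (u n) t).
  { induction n; simpl; auto. }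
  assert (Hstep : forall n t, Rabs (u (S n) t - u n t) <= K * (1 / 2) ^ n).
  { induction n; intros t.
    - simpl. rewrite Rmult_1_r. apply HK.
    - replace (K * (1 / 2) ^ S n) with (K * (1 / 2) ^ n * (1 / 2)) by (simpl; ring).
      apply (Hc (u (S n)) (u n)); auto. }
  (* The steps from [n] on sum to a finite geometric series; the exact factor 1 - 2^(-k) lets the
     induction on [k] close. *)
  assert (Hgap : forall k n t,
    Rabs (u (n + k)%nat t - u n t) <= 2 * K * (1 / 2) ^ n * (1 - (1 / 2) ^ k)).
  { induction k; intros n t.
    - rewrite Nat.add_0_r, Rminus_diag, Rabs_R0. simpl. lra.
    - replace (u (n + S k)%nat t - u n t)
        with ((u (S n + k)%nat t - u (S n) t) + (u (S n) t - u n t))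
        by (rewrite Nat.add_succ_comm; ring).
      apply Rle_trans with (1 := Rabs_triang _ _).
      pose proof (IHk (S n) t) as H1. pose proof (Hstep n t) as H2.
      simpl pow in *. lra. }
  assert (HKp : 0 <= K) by (apply Rle_trans with (2 := HK 0), Rabs_pos).
  assert (Hgap' : forall n m t, (n <= m)%nat ->
    Rabs (u m t - u n t) <= 2 * K * (1 / 2) ^ n).
  { intros n m t Hnm. replace m with (n + (m - n))%nat by lia.
    apply Rle_trans with (1 := Hgap _ _ _).
    rewrite <- (Rmult_1_r (2 * K * (1 / 2) ^ n)) at 2.
    apply Rmult_le_compat_l.
    - apply Rmult_le_pos; [lra|]. apply pow_le; lra.
    - assert (0 <= (1 / 2) ^ (m - n)) by (apply pow_le; lra). lra. }
  assert (Hlim : forall t, ex_finite_lim_seq (fun n => u n t)).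
  { intros t. apply ex_lim_seq_cauchy_corr. intros e.
    assert (He2 : 0 < e / 2) by (pose proof (cond_pos e); lra).
    destruct (is_lim_seq_geom_half (2 * K) _ (locally_ball 0 (mkposreal _ He2)))
      as [N HN].
    assert (HN' : Rabs (2 * K * (1 / 2) ^ N - 0) < e / 2) by exact (HN N (le_n N)).
    apply Rabs_def2 in HN'.
    exists N. intros n m Hn Hm.
    pose proof (Hgap' N n t Hn) as H1. pose proof (Hgap' N m t Hm) as H2.
    apply Rabs_le_between in H1. apply Rabs_le_between in H2.
    apply Rabs_def1; lra. }
  set (w := fun t => real (Lim_seq (fun n => u n t))).
  assert (Hw : forall t, is_lim_seq (fun n => u n t) (w t)).
  { intros t. now apply Lim_seq_correct'. }
  assert (Hwu : forall n t, Rabs (w t - u n t) <= 2 * K * (1 / 2) ^ n).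
  { intros n t.
    apply (is_lim_seq_le (fun m => Rabs (u (m + n)%nat t - u n t))
             (fun _ => 2 * K * (1 / 2) ^ n) (Rabs (w t - u n t)) (2 * K * (1 / 2) ^ n)).
    - intros m. apply Hgap'. lia.
    - apply (is_lim_seq_abs _ (w t - u n t)). apply is_lim_seq_minus'.
      + now apply -> (is_lim_seq_incr_n (fun m => u m t)).
      + apply is_lim_seq_const.
    - apply is_lim_seq_const. }
  assert (Cw : forall t, continuous w t).
  { apply (uniform_limit_continuous u w (fun n => 2 * K * (1 / 2) ^ n)); auto.
    apply is_lim_seq_geom_half. }
  exists w. split; [exact Cw|]. intros t.
  apply Rminus_diag_uniq.
  (* [w] is within K 2^(-n) of [u (S n)], which is [F (u n)] and lies within K 2^(-n) of [F w]; then
     n tends to infinity. *)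
  assert (H : Rabs (w t - F w t) <= 0).
  { apply (is_lim_seq_le (fun _ => Rabs (w t - F w t))
             (fun n => 2 * K * (1 / 2) ^ n) (Rabs (w t - F w t)) 0).
    - intros n.
      pose proof (Hwu (S n) t) as H1.
      pose proof (Hc w (u n) _ Cw (Cu n) (Hwu n) t) as H2.
      change (F (u n) t) with (u (S n) t) in H2. simpl pow in H1.
      apply Rabs_le_between in H1. apply Rabs_le_between in H2.
      apply Rabs_le. lra.
    - apply is_lim_seq_const.
    - apply is_lim_seq_geom_half. }
  destruct (Req_dec (w t - F w t) 0) as [E|E]; [exact E|].
  pose proof (Rabs_pos_lt _ E). lra.
Qed.

(** * Primitives and local solutions of differential equations *)

Lemma exists_primitive (phi : R -> R) (T0 T1 t0 v : R) :
  T0 < t0 < T1 -> (forall t, T0 < t < T1 -> continuous phi t) ->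
  exists P : R -> R, P t0 = v /\ forall t, T0 < t < T1 -> is_derive P t (phi t).
Proof.
  intros H0 Hphi. exists (fun t => v + RInt phi t0 t). split.
  - rewrite RInt_point. unfold zero; simpl. ring.
  - intros t Ht. replace (phi t) with (0 + phi t) by ring.
    apply (is_derive_plus (fun _ => v) (fun t => RInt phi t0 t)).
    + apply (is_derive_const (V := R_NormedModule) v t).
    + apply (is_derive_RInt phi _ t0); [|now apply Hphi].
      apply (locally_interval _ t T0 T1); [apply Ht|apply Ht|].
      intros x H1 H2. simpl in H1, H2.
      apply (@RInt_correct R_CompleteNormedModule).
      apply (@ex_RInt_continuous R_CompleteNormedModule).
      intros z [Hz1 Hz2]. apply Hphi. revert Hz1 Hz2.
      unfold Rmin, Rmax. destruct (Rle_dec t0 x); lra.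
Qed.

(** The increment splits into a change of the second argument, controlled by the Lipschitz bound
    uniformly in time, and a change of time with the second argument frozen at [u t]. *)
Lemma continuous_comp_lipschitz2 (G : R -> R -> R) (L : R) (u : R -> R) :
  (forall x t, continuous (fun t' => G t' x) t) ->
  (forall t x y, Rabs (G t x - G t y) <= L * Rabs (x - y)) ->
  (forall t, continuous u t) -> forall t, continuous (fun t' => G t' (u t')) t.
Proof.
  intros HG HL Hu t. apply filterlim_locally. intros eps.
  set (K := Rabs L + 1).
  assert (HK : 0 < K) by (unfold K; pose proof (Rabs_pos L); lra).
  assert (H2 : 0 < eps / 2) by (pose proof (cond_pos eps); lra).
  assert (H2' : 0 < eps / 2 / K) by now apply Rdiv_lt_0_compat.
  generalize (filter_and _ _
    (proj1 (filterlim_locally _ _) (HG (u t) t) (mkposreal _ H2))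
    (proj1 (filterlim_locally _ _) (Hu t) (mkposreal _ H2'))).
  apply filter_imp. intros x [H3 H4].
  assert (H3' : Rabs (G x (u t) - G t (u t)) < eps / 2) by exact H3.
  assert (H4' : Rabs (u x - u t) < eps / 2 / K) by exact H4.
  change (Rabs (G x (u x) - G t (u t)) < eps).
  replace (G x (u x) - G t (u t))
    with ((G x (u x) - G x (u t)) + (G x (u t) - G t (u t))) by ring.
  apply Rle_lt_trans with (1 := Rabs_triang _ _).
  assert (Rabs (G x (u x) - G x (u t)) <= eps / 2); [|lra].
  apply Rle_trans with (1 := HL _ _ _).
  replace (eps / 2) with (K * (eps / 2 / K)) by (field; lra).
  apply Rle_trans with (K * Rabs (u x - u t)).
  - apply Rmult_le_compat_r; [apply Rabs_pos|]. unfold K. pose proof (Rle_abs L); lra.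
  - apply Rmult_le_compat_l; lra.
Qed.

Lemma Rabs_RInt_le (phi : R -> R) (p q M : R) :
  (forall t, continuous phi t) -> (forall t, Rabs (phi t) <= M) ->
  Rabs (RInt phi p q) <= Rabs (q - p) * M.
Proof.
  intros Hc HM. apply (norm_RInt_le_const_abs phi p q).
  - intros x _. apply HM.
  - apply (@RInt_correct R_CompleteNormedModule).
    apply (@ex_RInt_continuous R_CompleteNormedModule). auto.
Qed.

(* The time variable of the integral operator is clamped to the interval, which makes
   it a contraction of the continuous functions on the whole line. *)
Lemma picard (G : R -> R -> R) (L B t1 rho : R) :
  0 < rho -> L * rho <= 1 / 2 ->
  (forall x t, continuous (fun t' => G t' x) t) ->
  (forall t x y, Rabs (G t x - G t y) <= L * Rabs (x - y)) ->
  (forall t x, Rabs (G t x) <= B) ->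
  exists w : R -> R,
    (forall t, continuous w t) /\ w t1 = 0 /\ (forall t, Rabs (w t) <= B * rho) /\
    forall t, t1 - rho < t < t1 + rho -> is_derive w t (G t (w t)).
Proof.
  intros Hr HLr HG HL HB.
  (* The Lipschitz bound at two points at distance 1 forces the sign of [L]. *)
  assert (HL0 : 0 <= L).
  { pose proof (HL 0 1 0) as H. rewrite Rminus_0_r, Rabs_R1 in H.
    pose proof (Rabs_pos (G 0 1 - G 0 0)). lra. }
  assert (HB0 : 0 <= B) by (apply Rle_trans with (2 := HB 0 0), Rabs_pos).
  set (cl := clamp (t1 - rho) (t1 + rho)).
  set (F := fun (u : R -> R) (t : R) => RInt (fun t' => G t' (u t')) t1 (cl t)).
  (* All integrals run over a segment of length at most [rho]; hence the bound B rho on the values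
     and the contraction factor L rho <= 1/2. *)
  assert (Hcl : forall t, Rabs (cl t - t1) <= rho).
  { intros t. apply Rabs_le. pose proof (clamp_bounds (t1 - rho) (t1 + rho) t).
    unfold cl. lra. }
  assert (HGu : forall u, (forall t, continuous u t) ->
    forall t, continuous (fun t' => G t' (u t')) t).
  { intros u Hu. now apply (continuous_comp_lipschitz2 G L). }
  assert (Hprim : forall u, (forall t, continuous u t) -> forall t,
    is_derive (fun q => RInt (fun t' => G t' (u t')) t1 q) t (G t (u t))).
  { intros u Hu t. apply (is_derive_RInt (fun t' => G t' (u t')) _ t1).
    - apply filter_forall. intros q.
      apply (@RInt_correct R_CompleteNormedModule).
      apply (@ex_RInt_continuous R_CompleteNormedModule). auto.
    - now apply HGu. }
  assert (HFb : forall u, (forall t, continuous u t) ->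
    forall t, Rabs (F u t) <= B * rho).
  { intros u Hu t. apply Rle_trans with (Rabs (cl t - t1) * B).
    - apply Rabs_RInt_le; auto.
    - rewrite Rmult_comm. now apply Rmult_le_compat_l. }
  destruct (contraction_fixed_point F (fun _ => 0) (B * rho)) as (w & Cw & Hw).
  - intros t. apply continuous_const.
  - intros u Hu t. apply (continuous_comp cl
      (fun q => RInt (fun t' => G t' (u t')) t1 q)).
    + apply clamp_continuous.
    + apply (ex_derive_continuous (V := R_NormedModule)).
      eexists. now apply Hprim.
  - intros t. rewrite Rminus_0_r. apply HFb. intros; apply continuous_const.
  - intros u v M Hu Hv HM t. unfold F.
    rewrite <- (RInt_minus (V := R_CompleteNormedModule));
      try (apply (@ex_RInt_continuous R_CompleteNormedModule); auto).
    assert (HM0 : 0 <= M) by (apply Rle_trans with (2 := HM 0), Rabs_pos).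
    apply Rle_trans with (Rabs (cl t - t1) * (L * M)).
    + apply Rabs_RInt_le.
      * intros x. apply (continuous_minus (V := R_NormedModule)); auto.
      * intros x. apply Rle_trans with (1 := HL _ _ _).
        now apply Rmult_le_compat_l.
    + apply Rle_trans with (rho * (L * M)).
      * apply Rmult_le_compat_r; [now apply Rmult_le_pos|apply Hcl].
      * replace (rho * (L * M)) with (M * (L * rho)) by ring.
        now apply Rmult_le_compat_l.
  - exists w. split; [exact Cw|]. split; [|split].
    + rewrite Hw. unfold F, cl. rewrite clamp_id by lra.
      exact (RInt_point (V := R_CompleteNormedModule) t1 _).
    + intros t. rewrite Hw. now apply HFb.
    + intros t Ht.
      (* Near an interior point the clamp is the identity, so [w] agrees there with the unclamped
         integral. *)
      apply (is_derive_ext_loc (fun q => RInt (fun t' => G t' (w t')) t1 q)).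
      * apply (locally_interval _ t (t1 - rho) (t1 + rho)); try apply Ht.
        intros x H1 H2. simpl in H1, H2. rewrite (Hw x). unfold F, cl.
        now rewrite clamp_id by lra.
      * now apply Hprim.
Qed.

(** * Continuity rules for the integrands *)

Lemma continuous_Rplus (u v : R -> R) (t : R) :
  continuous u t -> continuous v t -> continuous (fun x => u x + v x) t.
Proof. exact (continuous_plus (V := R_NormedModule) u v t). Qed.

Lemma continuous_Rminus (u v : R -> R) (t : R) :
  continuous u t -> continuous v t -> continuous (fun x => u x - v x) t.
Proof. exact (continuous_minus (V := R_NormedModule) u v t). Qed.

Lemma continuous_Rmult (u v : R -> R) (t : R) :
  continuous u t -> continuous v t -> continuous (fun x => u x * v x) t.
Proof. exact (continuous_mult (K := R_AbsRing) u v t). Qed.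

Lemma continuous_Rdiv (u v : R -> R) (t : R) :
  continuous u t -> continuous v t -> v t <> 0 -> continuous (fun x => u x / v x) t.
Proof.
  intros Hu Hv H0. apply continuous_Rmult; [exact Hu|].
  now apply continuous_Rinv_comp.
Qed.

Lemma is_derive_continuous (u : R -> R) (t l : R) : is_derive u t l -> continuous u t.
Proof.
  intros H. apply (ex_derive_continuous (V := R_NormedModule)). now exists l.
Qed.

(* [auto_derive] leaves derivatives of eta-expanded functions, which [rewrite] does not
   identify with their eta-reduced forms. *)
Lemma is_derive_unique_eta (u : R -> R) (t l : R) :
  is_derive u t l -> Derive (fun x : R => u x) t = l.
Proof. exact (is_derive_unique u t l). Qed.

Lemma continuous_Rpower (u : R -> R) (t s : R) :
  continuous u t -> 0 < u t -> continuous (fun x => Rpower (u x) s) t.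
Proof.
  intros Hu H0. apply continuous_exp_comp, continuous_Rmult.
  - apply continuous_const.
  - apply (continuous_comp u ln); [exact Hu|].
    eapply is_derive_continuous. now apply is_derive_ln.
Qed.

Lemma continuous_Rpow (u : R -> R) (n : nat) (t : R) :
  continuous u t -> continuous (fun x => u x ^ n) t.
Proof.
  intros Hu. induction n as [|n IHn]; simpl.
  - apply continuous_const.
  - now apply continuous_Rmult.
Qed.

(** Division is left out, as it would ask for a nonzero denominator; leaves other than constants
    must be hypotheses. *)
Ltac continuity_by :=
  lazymatch goal with
  | |- continuous (fun _ => ?k) _ => exact (continuous_const k _)
  | |- continuous (fun x => @?u x + @?v x) _ =>
      apply (continuous_Rplus u v); continuity_by
  | |- continuous (fun x => @?u x - @?v x) _ =>
      apply (continuous_Rminus u v); continuity_by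
  | |- continuous (fun x => @?u x * @?v x) _ =>
      apply (continuous_Rmult u v); continuity_by
  | |- continuous (fun x => @?u x ^ ?n) _ =>
      apply (continuous_Rpow u n); continuity_by
  | |- continuous (fun x => exp (@?u x)) _ =>
      apply (continuous_exp_comp u); continuity_by
  | |- _ => assumption
  end.

(** * The inverted Riccati equation with a prescribed zero *)

(* [1 / y] blows up at the zero [Tb] of [y], where the equation for [y] is regular. *)
Lemma inverse_riccati (a b c : R -> R) (t0 r M : R) :
  0 < r -> a t0 <> 0 ->
  (forall t, t0 - r <= t <= t0 + r ->
     continuous a t /\ continuous b t /\ continuous c t /\
     Rabs (a t) <= M /\ Rabs (b t) <= M /\ Rabs (c t) <= M /\
     Rabs (a t - a t0) <= Rabs (a t0) / 2) ->
  exists (rho : R) (y : R -> R),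
    0 < rho /\ rho < r /\ (forall t, continuous y t) /\ y (t0 + rho) = 0 /\
    (forall t, t0 - rho < t < t0 + rho ->
       y t * a t0 < 0 /\
       is_derive y t (b t * y t ^ 2 + 2 * c t * y t + 4 * a t)).
Proof.
  intros Hr Ha0 Hloc.
  assert (HA : 0 < Rabs (a t0)) by now apply Rabs_pos_lt.
  assert (HM : 0 < M).
  { apply Rlt_le_trans with (1 := HA). apply (Hloc t0). lra. }
  (* r / 2 keeps the Picard interval inside the given one; 1 / (8 M) gives both the contraction and
     |y| <= 7 M rho < 1; the third bound, 21 M^2 rho <= |a(t0)|, fixes the sign of y'. *)
  set (rho := Rmin (r / 2) (Rmin (/ (8 * M)) (Rabs (a t0) / (21 * M ^ 2)))).
  assert (HM2 : 0 < M ^ 2) by now apply pow_lt.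
  assert (Hrho : 0 < rho).
  { unfold rho. repeat apply Rmin_glb_lt; [lra| |].
    - apply Rinv_0_lt_compat. lra.
    - apply Rdiv_lt_0_compat; lra. }
  assert (Hrho1 : rho <= r / 2) by apply Rmin_l.
  assert (Hrho2 : M * rho <= 1 / 8).
  { apply Rle_trans with (M * / (8 * M)).
    - apply Rmult_le_compat_l; [lra|].
      apply Rle_trans with (1 := Rmin_r _ _). apply Rmin_l.
    - right. field. lra. }
  assert (Hrho3 : 21 * M ^ 2 * rho <= Rabs (a t0)).
  { apply Rle_trans with (21 * M ^ 2 * (Rabs (a t0) / (21 * M ^ 2))).
    - apply Rmult_le_compat_l; [lra|].
      apply Rle_trans with (1 := Rmin_r _ _). apply Rmin_r.
    - right. field. lra. }
  clearbody rho.
  set (cl := clamp (t0 - r) (t0 + r)).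
  assert (Hcl : forall t, t0 - r <= cl t <= t0 + r)
    by (intros t; apply clamp_bounds; lra).
  (* Truncating the unknown to [-1, 1] makes the quadratic right-hand side globally Lipschitz with
     constant 4 M and bounded by 7 M. *)
  set (q := clamp (-1) 1).
  assert (Hq : forall x, Rabs (q x) <= 1).
  { intros x. apply Rabs_le. apply clamp_bounds. lra. }
  set (G := fun t x => b (cl t) * q x ^ 2 + 2 * c (cl t) * q x + 4 * a (cl t)).
  assert (Hquad : forall t x, Rabs (b (cl t) * x + 2 * c (cl t)) <= M * Rabs x + 2 * M).
  { intros t x. apply Rle_trans with (1 := Rabs_triang _ _).
    rewrite !Rabs_mult, (Rabs_pos_eq 2) by lra.
    destruct (Hloc (cl t) (Hcl t)) as (_ & _ & _ & _ & Hb & Hc & _).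
    apply Rplus_le_compat; [|lra].
    apply Rmult_le_compat_r; [apply Rabs_pos|exact Hb]. }
  destruct (picard G (4 * M) (7 * M) (t0 + rho / 2) rho) as (y & Cy & y0 & By & Dy).
  - exact Hrho.
  - lra.
  - intros x t. unfold G.
    assert (continuous (fun t' => a (cl t')) t /\ continuous (fun t' => b (cl t')) t
            /\ continuous (fun t' => c (cl t')) t) as (Ca & Cb & Cc).
    { split; [|split]; apply continuous_comp_clamp; try lra; intros; now apply Hloc. }
    continuity_by.
  - intros t x x'. unfold G.
    replace (_ - _) with ((b (cl t) * (q x + q x') + 2 * c (cl t)) * (q x - q x'))
      by ring.
    rewrite Rabs_mult. apply Rmult_le_compat; try apply Rabs_pos.
    + apply Rle_trans with (1 := Hquad _ _).
      assert (Rabs (q x + q x') <= 2).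
      { apply Rle_trans with (1 := Rabs_triang _ _). pose proof (Hq x). pose proof (Hq x'). lra. }
      nra.
    + apply clamp_lipschitz.
  - intros t x. unfold G.
    replace (_ + _) with ((b (cl t) * q x + 2 * c (cl t)) * q x + 4 * a (cl t)) by ring.
    apply Rle_trans with (1 := Rabs_triang _ _).
    rewrite !Rabs_mult, (Rabs_pos_eq 4) by lra.
    destruct (Hloc (cl t) (Hcl t)) as (_ & _ & _ & Ha & _).
    pose proof (Hquad t (q x)). pose proof (Hq x). pose proof (Rabs_pos (q x)).
    pose proof (Rabs_pos (b (cl t) * q x + 2 * c (cl t))). nra.
  - exists (rho / 2), y.
    set (y' := fun t => b t * y t ^ 2 + 2 * c t * y t + 4 * a t).
    (* Both truncations are inactive here: the time lies in the given interval and |y| < 1. *)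
    assert (Dy' : forall t, t0 - rho / 2 < t < t0 + rho -> is_derive y t (y' t)).
    { intros t Ht. specialize (Dy t ltac:(lra)).
      unfold G, cl, q in Dy.
      rewrite (clamp_id (t0 - r) (t0 + r) t) in Dy by lra.
      rewrite (clamp_id (-1) 1 (y t)) in Dy; [exact Dy|].
      apply Rabs_le_between. apply Rle_trans with (1 := By t). lra. }
    (* The leading term is 4 a(t0)^2; the variation of [a] costs at most 2 a(t0)^2 and the terms in
       y at most a(t0)^2. *)
    assert (Hsign : forall t, t0 - rho / 2 < t < t0 + rho -> 0 < y' t * a t0).
    { intros t Ht.
      replace (y' t * a t0) with
        ((b t * y t + 2 * c t) * y t * a t0 + 4 * (a t - a t0) * a t0 + 4 * (a t0 * a t0))
        by (unfold y'; ring).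
      destruct (Hloc t ltac:(lra)) as (_ & _ & _ & _ & _ & _ & Ha).
      assert (H1 : Rabs ((b t * y t + 2 * c t) * y t * a t0) <= Rabs (a t0) * Rabs (a t0)).
      { rewrite Rabs_mult. apply Rmult_le_compat_r; [apply Rabs_pos|].
        rewrite Rabs_mult.
        pose proof (Hquad t (y t)) as H2. unfold cl in H2. rewrite clamp_id in H2 by lra.
        pose proof (By t) as H3. pose proof (Rabs_pos (y t)) as H4.
        apply Rle_trans with (3 * M * (7 * M * rho)); [|lra].
        apply Rmult_le_compat; try apply Rabs_pos; [|exact H3]. nra. }
      assert (H2 : Rabs (4 * (a t - a t0) * a t0) <= 2 * (Rabs (a t0) * Rabs (a t0))).
      { rewrite !Rabs_mult, (Rabs_pos_eq 4) by lra. nra. }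
      rewrite <- Rabs_mult, (Rabs_pos_eq (a t0 * a t0)) in H1, H2 by apply Rle_0_sqr.
      assert (0 < a t0 * a t0) by now apply Rsqr_pos_lt.
      apply Rabs_le_between in H1. apply Rabs_le_between in H2. lra. }
    split; [lra|]. split; [lra|]. split; [exact Cy|]. split; [exact y0|].
    intros t Ht. split; [|apply Dy'; lra].
    (* Before its zero, y is minus y' at an intermediate point times the remaining time, so its sign
       is opposite to that of a(t0). *)
    destruct (MVT_gen y t (t0 + rho / 2) y') as (xi & Hxi & E).
    + intros x. rewrite Rmin_left, Rmax_right by lra. intros Hx. apply Dy'. lra.
    + intros x _. apply continuity_pt_filterlim, Cy.
    + rewrite Rmin_left, Rmax_right in Hxi by lra. rewrite y0 in E.
      pose proof (Hsign xi ltac:(lra)).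
      replace (y t * a t0) with (- (y' xi * a t0 * (t0 + rho / 2 - t)))
        by (transitivity (- (y' xi * (t0 + rho / 2 - t)) * a t0); [|rewrite <- E]; ring).
      assert (0 < y' xi * a t0 * (t0 + rho / 2 - t)); [|lra].
      apply Rmult_lt_0_compat; lra.
Qed.

(** * The Riccati system solved by quadratures *)

(** With alpha = 1 / y, the equation for y reads y' / y = b y + 2 c + 4 a alpha. Hence 4 a alpha,
    singular at [Tb], is y' / y up to a regular term: mu and beta become a power y or 1 / y times an
    exponential of a regular integral. *)
Lemma modified_riccati_of_inverse (a b c d f g h y : R -> R) (s T0 Tb T1 t0 : R)
    (beta0 gamma0 delta0 eps0 kappa0 mu0 : R) :
  T0 < t0 < Tb -> Tb < T1 -> 0 < mu0 ->
  (forall t, T0 < t < T1 ->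
     continuous a t /\ continuous b t /\ continuous c t /\ continuous d t /\
     continuous f t /\ continuous g t /\ continuous h t) ->
  (forall t, T0 < t < Tb -> a t <> 0) ->
  (forall t, continuous y t) -> y Tb = 0 ->
  (forall t, T0 < t < Tb ->
     0 < y t / y t0 /\ is_derive y t (b t * y t ^ 2 + 2 * c t * y t + 4 * a t)) ->
  exists alpha beta gamma delta eps kappa mu : R -> R,
    modified_riccati a b c d f g h s (time_itv T0 Tb)
      alpha beta gamma delta eps kappa mu /\
    beta t0 = beta0 /\ gamma t0 = gamma0 /\ delta t0 = delta0 /\
    eps t0 = eps0 /\ kappa t0 = kappa0 /\ mu t0 = mu0 /\
    filterlim mu (at_left Tb) (locally 0).
Proof.
  intros Ht0 HT1 Hmu0 Hcont Ha Cy yTb Hy.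
  assert (Hyn : forall t, T0 < t < Tb -> y t <> 0).
  { intros t Ht E. destruct (Hy t Ht) as [H _]. rewrite E in H.
    unfold Rdiv in H. lra. }
  assert (Hy0 := Hyn t0 Ht0).
  (* This primitive is taken up to [T1], beyond [Tb], so that mu will be continuous at [Tb]
     itself. *)
  destruct (exists_primitive (fun t => 2 * d t - b t * y t - 2 * c t) T0 T1 t0 0)
    as (P & P0 & DP); [lra| |].
  { intros t Ht. destruct (Hcont t Ht) as (? & ? & ? & ? & ? & ? & ?).
    pose proof (Cy t). continuity_by. }
  destruct (exists_primitive (fun t => b t * y t + c t) T0 T1 t0 0)
    as (Q & Q0 & DQ); [lra| |].
  { intros t Ht. destruct (Hcont t Ht) as (? & ? & ? & ? & ? & ? & ?).
    pose proof (Cy t). continuity_by. }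
  (* Variation of constants: delta is [D] times the homogeneous solution exp(Q) y(t0) / y, and the
     integrand is f + 2 g / y divided by that solution. *)
  destruct (exists_primitive (fun t => (f t * y t + 2 * g t) / y t0 / exp (Q t))
    T0 T1 t0 delta0) as (D & D0 & DD); [lra| |].
  { intros t Ht. destruct (Hcont t Ht) as (? & ? & ? & ? & ? & ? & ?).
    pose proof (Cy t). pose proof (is_derive_continuous _ _ _ (DQ t Ht)).
    apply continuous_Rdiv; [apply continuous_Rdiv; [|apply continuous_const|exact Hy0]| |].
    - continuity_by.
    - continuity_by.
    - apply Rgt_not_eq, exp_pos. }
  set (alpha := fun t => / y t).
  set (mu := fun t => mu0 * (y t / y t0) * exp (P t)).
  set (beta := fun t => beta0 * exp (Q t) * y t0 / y t).
  set (delta := fun t => y t0 / y t * exp (Q t) * D t).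
  assert (Hmu : forall t, T0 < t < Tb -> 0 < mu t).
  { intros t Ht. unfold mu. apply Rmult_lt_0_compat; [|apply exp_pos].
    apply Rmult_lt_0_compat; [exact Hmu0|]. now apply Hy. }
  assert (Dmu : forall t, T0 < t < Tb ->
    is_derive mu t (mu t * (4 * a t / y t + 2 * d t))).
  { intros t Ht. assert (Hyt := Hyn t Ht). destruct (Hy t Ht) as [_ DY].
    assert (DPt := DP t ltac:(lra)). unfold mu.
    auto_derive; [split; [eexists; exact DY|split; [eexists; exact DPt|auto]]|].
    rewrite (is_derive_unique_eta _ _ _ DY), (is_derive_unique_eta _ _ _ DPt).
    field. auto. }
  assert (Dalpha : forall t, T0 < t < Tb ->
    is_derive alpha t (- (b t + 2 * c t * alpha t + 4 * a t * alpha t ^ 2))).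
  { intros t Ht. assert (Hyt := Hyn t Ht). destruct (Hy t Ht) as [_ DY].
    unfold alpha.
    auto_derive; [split; [eexists; exact DY|auto]|].
    rewrite (is_derive_unique_eta _ _ _ DY). field. auto. }
  assert (Dbeta : forall t, T0 < t < Tb ->
    is_derive beta t (- ((c t + 4 * a t * alpha t) * beta t))).
  { intros t Ht. assert (Hyt := Hyn t Ht). destruct (Hy t Ht) as [_ DY].
    assert (DQt := DQ t ltac:(lra)). unfold beta, alpha.
    auto_derive; [split; [eexists; exact DQt|split; [eexists; exact DY|auto]]|].
    rewrite (is_derive_unique_eta _ _ _ DY), (is_derive_unique_eta _ _ _ DQt).
    field. auto. }
  assert (Ddelta : forall t, T0 < t < Tb ->
    is_derive delta t (f t + 2 * alpha t * g t - (c t + 4 * a t * alpha t) * delta t)).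
  { intros t Ht. assert (Hyt := Hyn t Ht). destruct (Hy t Ht) as [_ DY].
    assert (DQt := DQ t ltac:(lra)). assert (DDt := DD t ltac:(lra)).
    unfold delta, alpha.
    auto_derive; [repeat split; auto; eexists; eassumption|].
    rewrite (is_derive_unique_eta _ _ _ DY), (is_derive_unique_eta _ _ _ DQt),
      (is_derive_unique_eta _ _ _ DDt).
    field. repeat split; auto. apply Rgt_not_eq, exp_pos. }
  (* From here on the integrands involve 1 / y or a power of mu, so the primitives are taken only up
     to [Tb]. *)
  destruct (exists_primitive (fun t => - (a t * beta t ^ 2)) T0 Tb t0 gamma0)
    as (gamma & gamma_0 & Dgamma); [lra| |].
  { intros t Ht. destruct (Hcont t ltac:(lra)) as (? & ? & ? & ? & ? & ? & ?).
    pose proof (is_derive_continuous _ _ _ (Dbeta t Ht)).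
    apply (continuous_opp (V := R_NormedModule)). continuity_by. }
  destruct (exists_primitive (fun t => (g t - 2 * a t * delta t) * beta t) T0 Tb t0 eps0)
    as (eps & eps_0 & Deps); [lra| |].
  { intros t Ht. destruct (Hcont t ltac:(lra)) as (? & ? & ? & ? & ? & ? & ?).
    pose proof (is_derive_continuous _ _ _ (Dbeta t Ht)).
    pose proof (is_derive_continuous _ _ _ (Ddelta t Ht)). continuity_by. }
  destruct (exists_primitive
    (fun t => g t * delta t - a t * delta t ^ 2 - 2 * h t / Rpower (mu t) s) T0 Tb t0 kappa0)
    as (kappa & kappa_0 & Dkappa); [lra| |].
  { intros t Ht. destruct (Hcont t ltac:(lra)) as (? & ? & ? & ? & ? & ? & ?).
    pose proof (is_derive_continuous _ _ _ (Ddelta t Ht)).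
    apply continuous_Rminus; [continuity_by|].
    apply continuous_Rdiv; [continuity_by| |].
    - apply continuous_Rpower; [|now apply Hmu].
      exact (is_derive_continuous _ _ _ (Dmu t Ht)).
    (* [Rpower] is an exponential by definition, hence nonzero. *)
    - apply Rgt_not_eq, exp_pos. }
  exists alpha, beta, gamma, delta, eps, kappa, mu.
  split; [|split; [|split; [|split; [|split; [|split; [|split]]]]]]; auto.
  - intros t Ht. change (T0 < t < Tb) in Ht.
    assert (Hat := Ha t Ht). assert (Hyt := Hyn t Ht). assert (Hmt := Hmu t Ht).
    rewrite (is_derive_unique _ _ _ (Dmu t Ht)), (is_derive_unique _ _ _ (Dalpha t Ht)),
      (is_derive_unique _ _ _ (Dbeta t Ht)), (is_derive_unique _ _ _ (Dgamma t Ht)),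
      (is_derive_unique _ _ _ (Ddelta t Ht)), (is_derive_unique _ _ _ (Deps t Ht)),
      (is_derive_unique _ _ _ (Dkappa t Ht)).
    repeat match goal with |- _ /\ _ => split end;
      try (eexists; now auto); try reflexivity; try ring.
    + exact Hmt.
    + unfold alpha. field. repeat split; lra.
  - unfold beta. rewrite Q0, exp_0. field. exact Hy0.
  - unfold delta. rewrite Q0, exp_0, D0. field. exact Hy0.
  - unfold mu. rewrite P0, exp_0. field. exact Hy0.
  - assert (Cmu : continuous mu Tb).
    { unfold mu. pose proof (Cy Tb).
      pose proof (is_derive_continuous _ _ _ (DP Tb ltac:(lra))).
      apply continuous_Rmult; [|continuity_by].
      apply continuous_Rmult; [continuity_by|].
      apply continuous_Rdiv; [assumption|apply continuous_const|exact Hy0]. }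
    unfold continuous in Cmu.
    replace (mu Tb) with 0 in Cmu
      by (unfold mu; rewrite yTb; unfold Rdiv; ring).
    (* The two-sided limit of mu at [Tb] is restricted to the left. *)
    apply filterlim_filter_le_1 with (2 := Cmu).
    intros S HS. now apply filter_imp with (2 := HS).
Qed.

(** * Assembly of the three claims *)

Theorem theorem2 (tm tM : Rbar) (a b c d f g h : R -> R) (s : R)
  (hs : 0 < s)
  (ha : forall t : R, time_itv tm tM t -> a t <> 0) :
  (* every solution of the Riccati system gives solutions of the NLS system *)
  (forall (T0 T1 : Rbar) (alpha beta gamma delta eps kappa mu : R -> R),
     (forall t : R, time_itv T0 T1 t -> time_itv tm tM t) ->
     modified_riccati a b c d f g h s (time_itv T0 T1)
       alpha beta gamma delta eps kappa mu ->
     forall y z : R,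
       solves_coupled_nls a b c d f g h s (time_itv T0 T1)
         (ansatz alpha beta gamma delta eps kappa mu y)
         (ansatz alpha beta gamma delta eps kappa mu z)) /\
  (* they are singular at a finite time where mu vanishes *)
  (forall (T0 : Rbar) (Tb : R) (alpha beta gamma delta eps kappa mu : R -> R),
     Rbar_lt T0 Tb ->
     (forall t : R, time_itv T0 Tb t -> time_itv tm tM t) ->
     modified_riccati a b c d f g h s (time_itv T0 Tb)
       alpha beta gamma delta eps kappa mu ->
     filterlim mu (at_left Tb) (locally 0) ->
     forall y z : R,
       Linf_singular T0 Tb (ansatz alpha beta gamma delta eps kappa mu y) /\
       Linf_singular T0 Tb (ansatz alpha beta gamma delta eps kappa mu z)) /\
  (* such singular solutions exist, around any initial time t0 and with
     arbitrary values of beta, gamma, delta, eps, kappa, mu at t0 *)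
  ((forall t : R, time_itv tm tM t ->
      continuous a t /\ continuous b t /\ continuous c t /\ continuous d t /\
      continuous f t /\ continuous g t /\ continuous h t) ->
   forall t0 beta0 gamma0 delta0 eps0 kappa0 mu0 : R,
     time_itv tm tM t0 -> 0 < mu0 ->
     exists (T0 Tb : R) (alpha beta gamma delta eps kappa mu : R -> R),
       T0 < t0 < Tb /\
       (forall t : R, T0 <= t <= Tb -> time_itv tm tM t) /\
       modified_riccati a b c d f g h s (time_itv T0 Tb)
         alpha beta gamma delta eps kappa mu /\
       beta t0 = beta0 /\ gamma t0 = gamma0 /\ delta t0 = delta0 /\
       eps t0 = eps0 /\ kappa t0 = kappa0 /\ mu t0 = mu0 /\
       forall y z : R,
         solves_coupled_nls a b c d f g h s (time_itv T0 Tb)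
           (ansatz alpha beta gamma delta eps kappa mu y)
           (ansatz alpha beta gamma delta eps kappa mu z) /\
         Linf_singular T0 Tb (ansatz alpha beta gamma delta eps kappa mu y) /\
         Linf_singular T0 Tb (ansatz alpha beta gamma delta eps kappa mu z)).
Proof.
  split; [|split].
  - intros T0 T1 alpha beta gamma delta eps kappa mu HJ ric y z.
    apply (ansatz_solves a b c d f g h s (time_itv T0 T1)); auto.
  - intros T0 Tb alpha beta gamma delta eps kappa mu HT HJ ric Hlim y z.
    split; apply ansatz_singular; auto; intros t Ht; now apply ric.
  - intros Hcont t0 beta0 gamma0 delta0 eps0 kappa0 mu0 Ht0 Hmu0.
    assert (Ha0 := ha t0 Ht0).
    destruct (Hcont t0 Ht0) as (Ca & Cb & Cc & _).
    assert (HA : 0 < Rabs (a t0) / 2) by (pose proof (Rabs_pos_lt _ Ha0); lra).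
    assert (Hnear : locally t0 (fun t => time_itv tm tM t /\
      Rabs (a t - a t0) < Rabs (a t0) / 2 /\
      Rabs (b t - b t0) < 1 /\ Rabs (c t - c t0) < 1)).
    { apply filter_and.
      - apply (locally_interval _ t0 tm tM); try apply Ht0. intros t H1 H2. now split.
      - apply filter_and; [|apply filter_and].
        + exact (proj1 (filterlim_locally _ _) Ca (mkposreal _ HA)).
        + exact (proj1 (filterlim_locally _ _) Cb (mkposreal _ Rlt_0_1)).
        + exact (proj1 (filterlim_locally _ _) Cc (mkposreal _ Rlt_0_1)). }
    destruct Hnear as [e He].
    assert (He0 := cond_pos e).
    (* Halving [e] puts a closed interval inside the open ball. *)
    assert (Hr : forall t, t0 - e / 2 <= t <= t0 + e / 2 -> ball t0 e t).
    { intros t Ht. change (Rabs (t - t0) < e). apply Rabs_def1; lra. }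
    (* On this interval |a| <= 3/2 |a(t0)|, |b| <= |b(t0)| + 1 and |c| <= |c(t0)| + 1, all at most
       [M]. *)
    set (M := 2 * Rabs (a t0) + Rabs (b t0) + Rabs (c t0) + 1).
    destruct (inverse_riccati a b c t0 (e / 2) M)
      as (rho & y & Hrho & Hrho' & Cy & y0 & Hy); [lra|exact Ha0| |].
    { intros t Ht. destruct (He t (Hr t Ht)) as (H0 & H1 & H2 & H3).
      destruct (Hcont t H0) as (Ca' & Cb' & Cc' & _).
      pose proof (Rabs_triang_inv (a t) (a t0)). pose proof (Rabs_triang_inv (b t) (b t0)).
      pose proof (Rabs_triang_inv (c t) (c t0)).
      pose proof (Rabs_pos (b t0)). pose proof (Rabs_pos (c t0)).
      unfold M. repeat match goal with |- _ /\ _ => split end; auto; lra. }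
    assert (HJ : forall t, t0 - e / 2 <= t <= t0 + e / 2 -> time_itv tm tM t)
      by (intros t Ht; now apply He, Hr).
    destruct (modified_riccati_of_inverse a b c d f g h y s (t0 - rho) (t0 + rho)
                (t0 + e / 2) t0 beta0 gamma0 delta0 eps0 kappa0 mu0)
      as (alpha & beta & gamma & delta & eps & kappa & mu & ric & I1 & I2 & I3 & I4 & I5
          & I6 & Hlim); try lra; auto.
    { intros t Ht. apply Hcont, HJ. lra. }
    { intros t Ht. apply ha, HJ. lra. }
    { intros t Ht. split; [|now apply Hy].
      destruct (Hy t Ht) as [H1 _]. destruct (Hy t0 ltac:(lra)) as [H2 _].
      (* Both values of y have the sign opposite to a(t0), so their quotient is positive. *)
      replace (y t / y t0) with ((y t * a t0) * / (y t0 * a t0)).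
      - rewrite <- Rmult_opp_opp. apply Rmult_lt_0_compat; [lra|].
        pose proof (Rinv_lt_0_compat _ H2). lra.
      - field. split; intros E; rewrite E in H2; lra. }
    exists (t0 - rho), (t0 + rho), alpha, beta, gamma, delta, eps, kappa, mu.
    split; [lra|]. split; [intros t Ht; apply HJ; lra|].
    do 7 (split; [assumption|]).
    intros z z'. split; [|split].
    + apply (ansatz_solves a b c d f g h s (time_itv (t0 - rho) (t0 + rho))); auto.
      intros t [H1 H2]. simpl in H1, H2. apply ha, HJ. lra.
    + apply ansatz_singular; [simpl; lra|intros t Ht; now apply ric|exact Hlim].
    + apply ansatz_singular; [simpl; lra|intros t Ht; now apply ric|exact Hlim].
Qed.
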